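(* Let $X$ and $Y$ be proper and unbounded metric spaces and let $f:X\to Y$ be a homeomorphism. Then $f$ is strongly quasi-Möbius if and only if it is bi-Lipschitz. Furthermore, $f$ is Möbius if and only if $f$ is a similarity.
   Context: A metric space is proper if closed balls are compact. A homeomorphism $f:X\to Y$ is strongly quasi-Möbius if there is $C\ge1$ such that for all quadruples of distinct points $a,b,c,e\in X$, $\dfrac{d(f(a),f(c))\,d(f(b),f(e))}{d(f(a),f(e))\,d(f(b),f(c))}\le C\,\dfrac{d(a,c)\,d(b,e)}{d(a,e)\,d(b,c)}$; it is Möbius if equality holds with $C=1$ for all such quadruples. It is bi-Lipschitz if for some $L\ge1$, $L^{-1}d(x,y)\le d(f(x),f(y))\le L\,d(x,y)$ for all $x,y\in X$; it is a similarity if there is $\lambda>0$ with $d(f(x),f(y))=\lambda\,d(x,y)$ for all $x,y\in X$. *)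

(* Defs.v *)
From mathcomp Require Import all_boot all_order all_algebra.
From mathcomp Require Import all_classical all_reals all_analysis.

Set Implicit Arguments.
Unset Strict Implicit.
Unset Printing Implicit Defensive.

Import Order.TTheory GRing.Theory Num.Theory.

Local Open Scope classical_set_scope.
Local Open Scope ring_scope.

(* The library's [closed_ball] is the closure of an open ball, which in a
   general metric space can be smaller than [set y | mdist x y <= r]. *)
Definition proper_space (R : realType) (X : metricType R) : Prop :=
  forall (x : X) (r : R), compact [set y : X | mdist x y <= r].

Definition bounded_space (R : realType) (X : metricType R) : Prop :=
  exists M : R, forall x y : X, mdist x y <= M.

Definition homeomorphism (X Y : topologicalType) (f : X -> Y) : Prop :=
  continuous f /\
  exists g : Y -> X, [/\ continuous g, cancel f g & cancel g f].

Definition cross_ratio (R : realType) (X : metricType R) (a b c e : X) : R :=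
  (mdist a c * mdist b e) / (mdist a e * mdist b c).

Definition strongly_quasi_moebius (R : realType) (X Y : metricType R)
    (f : X -> Y) : Prop :=
  exists2 C : R, 1 <= C &
    forall a b c e : X, uniq [:: a; b; c; e] ->
      cross_ratio (f a) (f b) (f c) (f e) <= C * cross_ratio a b c e.

Definition moebius (R : realType) (X Y : metricType R) (f : X -> Y) : Prop :=
  forall a b c e : X, uniq [:: a; b; c; e] ->
    cross_ratio (f a) (f b) (f c) (f e) = cross_ratio a b c e.

Definition bi_lipschitz (R : realType) (X Y : metricType R)
    (f : X -> Y) : Prop :=
  exists2 L : R, 1 <= L &
    forall x y : X, L^-1 * mdist x y <= mdist (f x) (f y) <= L * mdist x y.

Definition similarity (R : realType) (X Y : metricType R) (f : X -> Y) : Prop :=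
  exists2 lambda : R, 0 < lambda &
    forall x y : X, mdist (f x) (f y) = lambda * mdist x y.

(* Main.v *)
Require Import Defs.
From mathcomp Require Import all_boot all_order all_algebra.
From mathcomp Require Import all_classical all_reals all_analysis.
From mathcomp Require Import ring lra.

(** Write [d] for the distances.  The idea is to send the fourth point of a
    cross ratio to infinity.  If [z] leaves every bounded set of [X] then [f z]
    leaves every bounded set of [Y]: closed balls of [Y] are compact, so their
    preimages under the homeomorphism [f] are compact, hence bounded
    ([exists_far_with_far_image]).  Since [d b z / d a z] tends to [1], and
    likewise for the images, the inequality
    [cross_ratio (f a) (f b) (f c) (f z) <= C * cross_ratio a b c z] becomes in
    the limit [g a c <= C * g b c], where [g x y := d (f x) (f y) / d x y] is
    the dilation of the pair [x, y] ([dilation_le_shared_point]).  Two pairs of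
    points are joined through a third pair sharing a point with each of them,
    so the dilations of any two pairs are comparable up to [C ^ 2]
    ([dilation_le]).  Taking one pair as a reference of dilation [lambda], the
    map [f] is bi-Lipschitz up to rescaling by [lambda], with constant [C ^ 2]
    ([lipschitz_up_to_scaling]).  A Moebius map has [C = 1], and the same
    bound then says that [f] multiplies all distances by [lambda].

    Conversely, each of the four distances of a cross ratio is distorted by a
    factor at most [L], so the cross ratio is distorted by at most [L ^ 4]; and
    a common factor [lambda] cancels. *)

Set Implicit Arguments.
Unset Strict Implicit.
Unset Printing Implicit Defensive.

Import Order.TTheory GRing.Theory Num.Theory.
Import numFieldNormedType.Exports.

Local Open Scope classical_set_scope.
Local Open Scope ring_scope.

(** * Points escaping to infinity *)

Lemma mdist_continuous (R : realType) (X : metricType R) (x : X) :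
  continuous (fun y : X => mdist x y : R).
Proof.
move=> y; apply/cvgrPdist_le => e e0.
have : \forall z \near y, mdist y z <= e.
  exact: (metricType_numDomainType.cvgr_dist_le (@cvg_id _ (nbhs y))).
apply: filterS => z yz.
have := metric_triangle x y z; have := metric_triangle x z y.
rewrite (metric_sym z y) ler_norml => ? ?; apply/andP; split; lra.
Qed.

Lemma compact_mdist_le (R : realType) (T : topologicalType) (X : metricType R)
    (h : T -> X) (K : set T) (x : X) :
  continuous h -> compact K ->
  exists N : R, forall t, K t -> mdist x (h t) <= N.
Proof.
move=> ch cK.
have /compact_bounded [N [_ bN]] : compact ((fun t => mdist x (h t) : R) @` K).
  apply: continuous_compact => //; apply: continuous_subspaceT => t.
  exact: (continuous_comp (ch t) (@mdist_continuous _ _ x (h t))).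
exists (N + 1) => t Kt; apply: le_trans (ler_norm _) _.
by apply: bN; [rewrite ltrDl | exists t].
Qed.

Lemma exists_far (R : realType) (X : metricType R) :
  ~ bounded_space X -> forall (a : X) (M : R), exists z, M < mdist a z.
Proof.
move=> unbX a M; apply: contrapT => /forallNP near_a; apply: unbX.
exists (M + M) => x y.
have le_M z : mdist a z <= M by rewrite leNgt; apply/negP/near_a.
have := metric_triangle x a y; have := le_M x; have := le_M y.
by rewrite (metric_sym x a); lra.
Qed.

(** The preimage of a closed ball of [Y] is bounded, being the compact image of
    that ball under the inverse homeomorphism; any point of [X] far enough from
    [a] lies outside it. *)
Lemma exists_far_with_far_image (R : realType) (X Y : metricType R)
    (f : X -> Y) :
  ~ bounded_space X -> proper_space Y -> homeomorphism f ->
  forall (a : X) (M : R),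
    exists z, M <= mdist a z /\ M <= mdist (f a) (f z).
Proof.
move=> unbX propY [_ [g [cg fK gK]]] a M.
have [N leN] := compact_mdist_le a cg (propY (f a) M).
have [z farz] := exists_far unbX a (Num.max M N).
move: farz; rewrite gt_max => /andP[Mz Nz].
exists z; split; first exact: ltW.
rewrite leNgt; apply/negP => /ltW /leN.
by rewrite fK leNgt Nz.
Qed.

(** * Comparing dilations *)

(** An epsilon-free form of passing to the limit in
    [A * (1 - s / u) <= B * (1 + t / v)] as [u] and [v] tend to infinity. *)
Lemma le_of_far_perturbation (R : realFieldType) (A B s t : R) :
    0 <= A -> 0 <= B -> 0 <= s -> 0 <= t ->
    (forall M, exists u v,
      [/\ M <= u, M <= v & A * (u - s) * v <= B * (v + t) * u]) ->
  A <= B.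
Proof.
move=> A0 B0 s0 t0 far; rewrite leNgt; apply/negP => BA.
have AB0 : 0 < A - B by rewrite subr_gt0.
have E0 : 0 <= A * s + B * t by rewrite addr_ge0 ?mulr_ge0.
(* For [u, v >= M] the hypothesis gives [(A - B) * M <= A * s + B * t]; this
   [M] is the first value, up to a margin of one, that contradicts it. *)
pose M := 1 + (A * s + B * t) / (A - B).
have M0 : 0 < M by rewrite ltr_pwDl // divr_ge0 // ltW.
have ME : (A - B) * M = (A - B) + (A * s + B * t).
  by rewrite /M mulrDr mulr1 mulrCA divff ?mulr1 // lt0r_neq0.
have [u [v [Mu Mv ineq]]] := far M.
have u0 : 0 < u by apply: lt_le_trans Mu.
have v0 : 0 < v by apply: lt_le_trans Mv.
have h1 : A * s * v * M <= A * s * v * u.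
  by rewrite ler_wpM2l // !mulr_ge0 // ltW.
have h2 : B * t * u * M <= B * t * u * v.
  by rewrite ler_wpM2l // !mulr_ge0 // ltW.
have h3 : M * (A * (u - s) * v) <= M * (B * (v + t) * u).
  by rewrite ler_wpM2l // ltW.
have h4 : 0 < (A - B) * (u * v) by rewrite !mulr_gt0.
have h5 : (A - B) * M * (u * v) = ((A - B) + (A * s + B * t)) * (u * v).
  by rewrite ME.
lra.
Qed.

Lemma ler_div_div (R : realFieldType) (K p q r s : R) :
  0 < q -> 0 < s -> (p / q <= K * (r / s)) = (p * s <= K * r * q).
Proof.
by move=> q0 s0; rewrite ler_pdivrMr // mulrA mulrAC ler_pdivlMr.
Qed.

(** The limit of the cross-ratio inequality as its fourth point goes to
    infinity.  In product form it holds for coinciding points as well. *)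
Lemma dilation_le_shared_point (R : realType) (X Y : metricType R) (f : X -> Y)
    (C : R) :
    ~ bounded_space X -> proper_space Y -> homeomorphism f -> 1 <= C ->
    (forall a b c e : X, uniq [:: a; b; c; e] ->
      cross_ratio (f a) (f b) (f c) (f e) <= C * cross_ratio a b c e) ->
  forall a b c : X,
    mdist (f a) (f c) * mdist b c <= C * (mdist a c * mdist (f b) (f c)).
Proof.
move=> unbX propY homeo_f C1 cross_ratio_le a b c.
have C0 : 0 <= C := le_trans ler01 C1.
have [->|ab] := eqVneq a b.
  by rewrite [leLHS]mulrC ler_peMl // mulr_ge0 ?mdist_ge0.
have [->|ac] := eqVneq a c; first by rewrite !mdistxx !(mul0r, mulr0).
have [->|bc] := eqVneq b c; first by rewrite !mdistxx !(mul0r, mulr0).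
have ab0 := mdist_ge0 a b; have ac0 := mdist_ge0 a c.
apply: (@le_of_far_perturbation _ _ _ (mdist (f a) (f b)) (mdist a b));
  rewrite ?mulr_ge0 ?mdist_ge0 // => M.
(* Beyond distance [d a b + d a c] from [a], the point [z] differs from [a],
   [b] and [c]. *)
have [z []] := exists_far_with_far_image unbX propY homeo_f a
  (Num.max M (mdist a b + mdist a c + 1)).
rewrite !ge_max => /andP[Mz abcz] /andP[Mfz _].
exists (mdist (f a) (f z)), (mdist a z); split => //.
have az : a != z by rewrite -mdist_gt0; lra.
have bz : b != z by apply/eqP => bz; move: abcz; rewrite -bz; lra.
have cz : c != z by apply/eqP => cz; move: abcz; rewrite -cz; lra.
have abczU : uniq [:: a; b; c; z].
  by rewrite /= !inE !negb_or ab ac az bc bz cz.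
have f_inj : injective f.
  by have [_ [g [_ fK _]]] := homeo_f; exact: can_inj fK.
have pos (x y : X) : x != y -> 0 < mdist x y by rewrite mdist_gt0.
have fpos (x y : X) : x != y -> 0 < mdist (f x) (f y).
  by move=> xy; rewrite mdist_gt0 (inj_eq f_inj).
have := cross_ratio_le _ _ _ _ abczU; rewrite /cross_ratio.
rewrite ler_div_div ?mulr_gt0 ?pos ?fpos // => finite_ineq.
have lower : mdist (f a) (f z) - mdist (f a) (f b) <= mdist (f b) (f z).
  by rewrite lerBlDl metric_triangle.
have upper : mdist b z <= mdist a z + mdist a b.
  by rewrite addrC (metric_sym a b) metric_triangle.
apply: (@le_trans _ _ (mdist (f a) (f c) * mdist b c * mdist (f b) (f z)
                       * mdist a z)).
  by rewrite ler_wpM2r ?ler_wpM2l ?mulr_ge0 ?mdist_ge0.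
apply: (@le_trans _ _ (C * (mdist a c * mdist (f b) (f c)) * mdist b z
                       * mdist (f a) (f z))); first by lra.
by rewrite ler_wpM2r ?ler_wpM2l ?mulr_ge0 ?mdist_ge0.
Qed.

(** The pair [y, p] shares a point with [x, y] and with [p, q], so this follows
    from two applications of the comparison of pairs sharing a point.  When
    [y = p] there is no third pair, but one application is enough. *)
Lemma dilation_le (R : realType) (X Y : metricType R) (f : X -> Y) (C : R) :
    1 <= C ->
    (forall a b c : X,
      mdist (f a) (f c) * mdist b c <= C * (mdist a c * mdist (f b) (f c))) ->
  forall x y p q : X,
    mdist (f x) (f y) * mdist p q <= C ^+ 2 * (mdist x y * mdist (f p) (f q)).
Proof.
move=> C1 shared x y p q; have C0 : 0 <= C := le_trans ler01 C1.
have [<-|yp] := eqVneq y p.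
  rewrite (metric_sym y q) (metric_sym (f y) (f q)).
  apply: le_trans (shared x q y) _.
  rewrite ler_wpM2r ?mulr_ge0 ?mdist_ge0 // expr2 ler_peMl //.
have py0 : 0 < mdist p y by rewrite mdist_gt0 eq_sym.
have xy_py := shared x p y.
have py_pq : mdist (f p) (f y) * mdist p q
             <= C * (mdist p y * mdist (f p) (f q)).
  have := shared y q p.
  by rewrite !(metric_sym y p, metric_sym q p, metric_sym (f y) (f p),
               metric_sym (f q) (f p)).
have step1 : mdist (f x) (f y) * mdist p y * mdist p q
             <= C * (mdist x y * mdist (f p) (f y)) * mdist p q.
  by rewrite ler_wpM2r ?mdist_ge0.
have step2 : C * mdist x y * (mdist (f p) (f y) * mdist p q)
             <= C * mdist x y * (C * (mdist p y * mdist (f p) (f q))).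
  by rewrite ler_wpM2l ?mulr_ge0 ?mdist_ge0.
by rewrite -(ler_pM2r py0); lra.
Qed.

(** The scale [lambda] is the dilation of an arbitrary reference pair. *)
Lemma lipschitz_up_to_scaling (R : realType) (X Y : metricType R) (f : X -> Y)
    (C : R) :
    ~ bounded_space X -> proper_space Y -> homeomorphism f -> 1 <= C ->
    (forall a b c e : X, uniq [:: a; b; c; e] ->
      cross_ratio (f a) (f b) (f c) (f e) <= C * cross_ratio a b c e) ->
  exists2 lambda : R, 0 < lambda & forall x y : X,
    mdist (f x) (f y) <= C ^+ 2 * (lambda * mdist x y) /\
    lambda * mdist x y <= C ^+ 2 * mdist (f x) (f y).
Proof.
move=> unbX propY homeo_f C1 cross_ratio_le.
have dil := dilation_le C1
  (dilation_le_shared_point unbX propY homeo_f C1 cross_ratio_le).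
have [p [q pq]] : exists p q : X, 0 < mdist p q.
  apply: contrapT => /forallNP no_pair; apply: unbX; exists 0 => p q.
  by rewrite leNgt; apply/negP; move: q; apply/forallNP.
have fpq : 0 < mdist (f p) (f q).
  have [_ [g [_ fK _]]] := homeo_f.
  by rewrite mdist_gt0 (inj_eq (can_inj fK)) -mdist_gt0.
exists (mdist (f p) (f q) / mdist p q); first exact: divr_gt0.
move=> x y; split.
  rewrite [X in _ * X]mulrAC [leRHS]mulrA ler_pdivlMr // (mulrC (mdist (f p) _)); exact: dil.
by rewrite mulrAC ler_pdivrMr // -mulrA (mulrC (mdist (f x) _)); exact: dil.
Qed.

(** * Distortion of cross ratios *)

Lemma bi_lipschitz_strongly_quasi_moebius (R : realType) (X Y : metricType R)
    (f : X -> Y) :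
  bi_lipschitz f -> strongly_quasi_moebius f.
Proof.
move=> [L L1 lipf]; have L0 : 0 < L := lt_le_trans ltr01 L1.
exists (L ^+ 4) => [|a b c e]; first exact: exprn_ege1.
rewrite /= !inE !negb_or andbT => /and3P[/and3P[ab ac ae] /andP[bc be] ce].
have lip x y : mdist (f x) (f y) <= L * mdist x y by case/andP: (lipf x y).
have colip x y : mdist x y <= L * mdist (f x) (f y).
  by rewrite -ler_pdivrMl //; case/andP: (lipf x y).
have pos (x y : X) : x != y -> 0 < mdist x y by rewrite mdist_gt0.
have fpos (x y : X) : x != y -> 0 < mdist (f x) (f y).
  by move=> /pos xy; rewrite -(pmulr_rgt0 _ L0) (lt_le_trans xy).
rewrite /cross_ratio ler_div_div ?mulr_gt0 ?pos ?fpos //.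
have num : mdist (f a) (f c) * mdist (f b) (f e)
           <= (L * mdist a c) * (L * mdist b e).
  by rewrite ler_pM ?mdist_ge0.
have den : mdist a e * mdist b c
           <= (L * mdist (f a) (f e)) * (L * mdist (f b) (f c)).
  by rewrite ler_pM ?mdist_ge0.
have := ler_pM (mulr_ge0 (mdist_ge0 _ _) (mdist_ge0 _ _))
  (mulr_ge0 (mdist_ge0 _ _) (mdist_ge0 _ _)) num den.
by congr (_ <= _); ring.
Qed.

Lemma similarity_moebius (R : realType) (X Y : metricType R) (f : X -> Y) :
  similarity f -> moebius f.
Proof.
move=> [l l0 simf] a b c e.
rewrite /= !inE !negb_or andbT => /and3P[/and3P[ab ac ae] /andP[bc be] ce].
rewrite /cross_ratio !simf; field.
by rewrite !gt_eqF ?mdist_gt0.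
Qed.

Theorem proposition1p7 (R : realType) (X Y : metricType R) (f : X -> Y)
    (properX : proper_space X) (unboundedX : ~ bounded_space X)
    (properY : proper_space Y) (unboundedY : ~ bounded_space Y)
    (homeo_f : homeomorphism f) :
  (strongly_quasi_moebius f <-> bi_lipschitz f) /\
  (moebius f <-> similarity f).
Proof.
split; split.
- move=> [C C1 qmf].
  have [l l0 lipf] := lipschitz_up_to_scaling unboundedX properY homeo_f C1 qmf.
  have K1 : 1 <= C ^+ 2 by exact: exprn_ege1.
  have K0 : 0 <= C ^+ 2 := le_trans ler01 K1.
  have li0 : 0 < l^-1 by rewrite invr_gt0.
  (* [l + l^-1] dominates both [l] and its inverse, and is at least [1] as one
     of these two is. *)
  have sum1 : 1 <= l + l^-1.
    have [l1|l1] := leP 1 l; first by rewrite (le_trans l1) // lerDl ltW.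
    by rewrite (le_trans (y := l^-1)) ?lerDr 1?ltW // invf_gt1.
  exists (C ^+ 2 * (l + l^-1)); first exact: mulr_ege1.
  move=> x y; have [fxy xyf] := lipf x y.
  rewrite ler_pdivrMl ?(lt_le_trans ltr01 (mulr_ege1 K1 sum1)) //.
  apply/andP; split.
    rewrite -ler_pdivlMl // in xyf; apply: le_trans xyf _.
    rewrite mulrA ler_wpM2r ?mdist_ge0 // mulrC ler_wpM2l //.
    by rewrite lerDr ltW.
  apply: le_trans fxy _; rewrite mulrA ler_wpM2r ?mdist_ge0 // ler_wpM2l //.
  by rewrite lerDl ltW.
- exact: bi_lipschitz_strongly_quasi_moebius.
- move=> moebf.
  have [] := lipschitz_up_to_scaling (C := 1) unboundedX properY homeo_f _ _.
  + by [].
  + by move=> a b c e u; rewrite mul1r moebf.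
  move=> l l0 lipf; exists l => // x y; have [fxy xyf] := lipf x y.
  by apply: le_anti; move: fxy xyf; rewrite !expr1n !mul1r => -> ->.
- exact: similarity_moebius.
Qed.
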